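(* Let $\{f_t\}_{t\in[0,1]}$ be a generic one-parameter PL family on a $d$-dimensional combinatorial manifold with triangulation $K$ and vertex set $V$. Let $u,v\in V$ be distinct vertices and $0\le t_1<t_2\le 1$ be such that the vertex curves of $u$ and $v$ cross in the open interval $(t_1,t_2)$, i.e. $f_{t_1}(v)>f_{t_1}(u)$, $f_{t_2}(v)<f_{t_2}(u)$, and the curves $t\mapsto f_t(u)$ and $t\mapsto f_t(v)$ intersect exactly once in $(t_1,t_2)$. Assume further that no other pair of vertex curves intersects at any time in $[t_1,t_2]$. Then \[ \sum_{i=0}^{d}(-1)^i\bigl(\beta_i^{t_2}(v)-\beta_i^{t_1}(v)\bigr)\;=\;-\sum_{i=0}^{d}(-1)^i\bigl(\beta_i^{t_2}(u)-\beta_i^{t_1}(u)\bigr). \]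
   Context: A combinatorial manifold of dimension $d$ is a finite simplicial complex $K$ triangulating a manifold $\mathbb{M}$ such that the link of every vertex is homeomorphic to a $(d-1)$-sphere. A PL function on $\mathbb{M}$ is given by assigning real values to the vertices of $K$ and extending linearly on each simplex. A one-parameter PL family $\{f_t\}_{t\in[0,1]}$ assigns to each $t$ a PL function $f_t$ on $K$, with each vertex curve $t\mapsto f_t(w)$ ($w\in V$) continuous (in practice piecewise linear in $t$). The family is generic if the collection of vertex curves $\{(t,f_t(w)) : t\in[0,1]\}$, $w\in V$, has only finitely many intersection points, each an intersection of exactly two curves, occurring at pairwise distinct times $0<T_1<\dots<T_n<1$, with no point where three or more curves meet. For a vertex $w$, $\mathrm{St}(w)=\{\sigma\in K: w\in\sigma\}$ and $\mathrm{Lk}(w)=\{\tau\in K:\exists\sigma\in\mathrm{St}(w),\ \tau\subset\sigma,\ w\notin\tau\}$. The lower link of $w$ at time $t$ is $\mathrm{Lk}_t^-(w)=\{\tau\in\mathrm{Lk}(w): f_t(x)\le f_t(w)\text{ for all vertices } x \text{ of } \tau\}$. The time-varying Betti numbers are $\beta_i^t(w)=\dim_{\mathbb{R}}\widetilde H_{i-1}(\mathrm{Lk}_t^-(w);\mathbb{R})$ for $i=0,\dots,d$, where $\widetilde H$ is reduced simplicial homology with the convention $\widetilde H_{-1}(X;\mathbb{R})=0$ if $X\neq\emptyset$ and $\widetilde H_{-1}(\emptyset;\mathbb{R})=\mathbb{R}$. *)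

(* Defs.v *)
From HB Require Import structures.
From mathcomp Require Import all_boot all_order all_algebra.
From mathcomp Require Import all_classical all_reals all_analysis.
Set Implicit Arguments. Unset Strict Implicit. Unset Printing Implicit Defensive.
Import Order.TTheory GRing.Theory Num.Theory.
Import numFieldNormedType.Exports.
Local Open Scope ring_scope.

Definition simplicial_complex (n : nat) (K : {set {set 'I_n}}) : Prop :=
  (forall s, s \in K -> s != finset.set0) /\
  (forall s t, s \in K -> t != finset.set0 -> t \subset s -> t \in K) /\
  (forall w : 'I_n, [set w] \in K).

Definition St n (K : {set {set 'I_n}}) (w : 'I_n) : {set {set 'I_n}} :=
  [set s in K | w \in s].
Definition Lk n (K : {set {set 'I_n}}) (w : 'I_n) : {set {set 'I_n}} :=
  [set tau in K | [exists s in St K w, (tau \subset s) && (w \notin tau)]].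

(* Geometric realization of a subcomplex L of the full simplex on 'I_n,
   inside R^n (barycentric coordinates). *)
Definition realization (R : realType) n (L : {set {set 'I_n}}) : set 'rV[R]_n :=
  (fun x => (forall i, 0 <= x ord0 i) /\ \sum_i x ord0 i = 1 /\
           [set i | x ord0 i != 0] \in L).


Definition sphere (R : realType) (d : nat) : set 'rV[R]_d :=
  (fun y => \sum_i y ord0 i ^+ 2 = 1).

Definition homeomorphic (R : realType) m k (A : set 'rV[R]_m) (B : set 'rV[R]_k) : Prop :=
  exists (f : 'rV[R]_m -> 'rV[R]_k) (g : 'rV[R]_k -> 'rV[R]_m),
    (forall x, A x -> B (f x)) /\ (forall y, B y -> A (g y)) /\
    (forall x, A x -> g (f x) = x) /\ (forall y, B y -> f (g y) = y) /\
    {within A, continuous f}%classic /\ {within B, continuous g}%classic.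


Definition combinatorial_manifold (R : realType) (d n : nat) (K : {set {set 'I_n}}) : Prop :=
  simplicial_complex K /\
  forall w : 'I_n, homeomorphic (@realization R n (Lk K w)) (@sphere R d).

(* One-parameter PL family: f t w = value of vertex w at time t;
   vertex curves continuous on [0,1]. *)
Definition family (R : realType) n (f : R -> 'I_n -> R) : Prop :=
  forall w, {within `[0, 1]%classic, continuous (fun t => f t w)}%classic.

Definition generic_family (R : realType) n (f : R -> 'I_n -> R) : Prop :=
  family f /\
  finite_set (fun t : R => t \in `[0, 1] /\ exists u v : 'I_n, u != v /\ f t u = f t v) /\
  (forall (t : R) (u v : 'I_n), t \in `[0, 1] -> u != v -> f t u = f t v ->
     (0 < t < 1) /\
     forall x y : 'I_n, x != y -> f t x = f t y -> [set x; y] = [set u; v]).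

Definition lower_link (R : realType) n (K : {set {set 'I_n}}) (f : R -> 'I_n -> R)
    (t : R) (w : 'I_n) : {set {set 'I_n}} :=
  [set tau in Lk K w | [forall x in tau, f t x <= f t w]].

(* Augmented chain complex of L: faces of cardinality k (k = 0: the empty face). *)
Definition faces n (L : {set {set 'I_n}}) (k : nat) : {set {set 'I_n}} :=
  [set s in finset.set0 |: L | #|s| == k].

(* Boundary C_k -> C_{k-1} (chains indexed by cardinality; row-vector convention).
   For k = 0 the matrix is zero. Orientation from the order of 'I_n. *)
Definition bdry (R : realType) n (L : {set {set 'I_n}}) (k : nat)
  : 'M[R]_(#|faces L k|, #|faces L k.-1|) :=
  \matrix_(i < #|faces L k|, j < #|faces L k.-1|)
    let s : {set 'I_n} := enum_val i in let t : {set 'I_n} := enum_val j in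
    \sum_(x in s | s :\ x == t) (-1) ^+ #|[set y in s | (y < x)%N]|.

Arguments bdry R {n} L k.

(* Reduced homology dimension in degree k-1 over R:
   dim H~_{k-1}(L; R) = dim C_k - rank d_k - rank d_{k+1}, with
   the convention H~_{-1}(empty) = R built into the augmentation. *)
Definition red_betti (R : realType) n (L : {set {set 'I_n}}) (k : nat) : nat :=
  (#|faces L k| - \rank (bdry R L k) - \rank (bdry R L k.+1))%N.

Arguments red_betti R {n} L k.

Definition beta (R : realType) n (K : {set {set 'I_n}}) (f : R -> 'I_n -> R)
    (t : R) (w : 'I_n) (i : nat) : nat :=
  red_betti R (lower_link K f t w) i.

(* Main.v *)
(** Over a field, the alternating sum of the reduced Betti numbers of the lower
link of [w] is the alternating sum of its face numbers, provided no face has more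
than [d] vertices.  Between [t1] and [t2] no vertex other than [u], [v] changes
its position relative to [u] or [v], so the lower link of [v] loses exactly its
faces containing [u], that of [u] gains exactly the faces containing [v], and
[s |-> (s \ u) + v] matches the two families.

The bound on the faces is invariance of dimension: a simplex with [m + 2] vertices
has no continuous injection into [R^m].  Colour [R^m] with [m + 1] colours such
that each colour class is a separated union of small cubes (in every coordinate
only one of [m + 1] residues is forbidden, so by pigeonhole every point has a
colour).  The preimage of a small cube is too small to meet all facets of the
simplex; label its points by a facet which it misses.  Sperner's lemma gives
[m + 2] pairwise close points with distinct labels, two of which share their
colour, hence their cube, hence their label.

Sperner's lemma is proved with mod 2 cochains on tuples of points: pulling back
along barycentric subdivision commutes with the coboundary. *)

Require Import Defs.
From HB Require Import structures.
From mathcomp Require Import all_boot all_order all_algebra.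
From mathcomp Require Import ring lra zify.
From mathcomp Require Import all_classical all_reals all_analysis.
Set Implicit Arguments. Unset Strict Implicit. Unset Printing Implicit Defensive.
Import Order.TTheory GRing.Theory Num.Theory.
Import numFieldNormedType.Exports.
Local Open Scope ring_scope.

(** * Mod 2 cochains on tuples and barycentric subdivision *)

Section Cochains.
Variables (T : Type) (b : seq T -> T).
Implicit Types (p : seq T -> 'F_2) (s : seq T).

Definition del s i := take i s ++ drop i.+1 s.

Definition cobd p s : 'F_2 := \sum_(i < size s) p (del s i).

(* [sd p s] evaluates the cochain [p] on the barycentric subdivision of the tuple
   [s], which is the cone from [b s] over the subdivided boundary of [s]. *)
Fixpoint sdk k p s : 'F_2 :=
  if k is k'.+1 then \sum_(i < size s) sdk k' (fun s' => p (b s :: s')) (del s i)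
  else p s.

Definition sd p s := sdk (size s) p s.

Lemma del0 x s : del (x :: s) 0 = s.
Proof. by rewrite /del /= drop0. Qed.

Lemma size_del s i : (i < size s)%N -> size (del s i) = (size s).-1.
Proof.
move=> lt_is; rewrite size_cat size_takel ?(ltnW lt_is) // size_drop.
by case: (size s) lt_is => // n; rewrite ltnS => le_in; rewrite subSS subnKC.
Qed.

Lemma sdE p s : sd p s = if s is [::] then p s else
  \sum_(i < size s) sd (fun s' => p (b s :: s')) (del s i).
Proof.
case: s => // x s; rewrite /sd [LHS]/=; apply: eq_bigr => i _.
by rewrite size_del.
Qed.

Lemma eq_sd p q s : p =1 q -> sd p s = sd q s.
Proof.
rewrite /sd => epq; move: (size s) => k.
elim: k p q s epq => [|k IH] p q s epq //=.
by apply: eq_bigr => i _; apply: IH => s'; apply: epq.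
Qed.

Lemma sdD p q s : sd (fun s => p s + q s) s = sd p s + sd q s.
Proof.
rewrite /sd; move: (size s) => k; elim: k p q s => [|k IH] p q s //=.
by rewrite -big_split; apply: eq_bigr => i _; rewrite /= -IH.
Qed.

Lemma F2_addrr (x : 'F_2) : x + x = 0.
Proof. by rewrite -mulr2n -mulr_natl (pchar_Fp_0 _) ?mul0r. Qed.

Lemma cobd_cons p x s :
  cobd p (x :: s) = p s + cobd (fun s' => p (x :: s')) s.
Proof. by rewrite /cobd big_ord_recl del0. Qed.

(** By [cobd_cons] the term [cobd p s] occurs twice and vanishes mod 2; what remains is a double
    coboundary on the shorter tuple. *)
Lemma cobd_cobd p s : cobd (cobd p) s = 0.
Proof.
elim: s p => [|x s IH] p; first by rewrite /cobd big_ord0.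
rewrite cobd_cons [X in _ + X](_ : _ =
  cobd (fun s' => p s' + cobd (fun s'' => p (x :: s'')) s') s); last first.
  by apply: eq_bigr => i _; rewrite cobd_cons.
rewrite {2}/cobd big_split /= [X in _ + (_ + X)]IH addr0.
exact: F2_addrr.
Qed.

(** The boundary of the cone over the subdivided boundary is its base plus the cone over a double
    boundary, and the latter vanishes by [cobd_cobd]. *)
Lemma sd_cobd p s : sd (cobd p) s = cobd (sd p) s.
Proof.
have [k] := ubnP (size s); elim: k s p => // k IH s p.
case: s => [|x s] ltsk; first by rewrite sdE /cobd !big_ord0.
rewrite sdE; set y := b _.
under eq_bigr => i _ do rewrite (eq_sd _ (cobd_cons p y)) sdD.
rewrite big_split /=.
under [X in _ + X]eq_bigr => i _ do rewrite IH ?size_del //.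
by rewrite [X in _ + X](cobd_cobd _ (x :: s)) addr0.
Qed.

End Cochains.

Lemma sumr_const_seq (R : pzRingType) (T : Type) (s : seq T) (c : R) :
  \sum_(x <- s) c = c *+ size s.
Proof. by rewrite big_const_seq count_predT iter_addr_0. Qed.

(** * Hulls and the mesh of iterated subdivisions *)

Section Sperner.
Variables (R : realFieldType) (T : eqType) (b : seq T -> T).
Implicit Types (p : seq T -> 'F_2) (s : seq T) (g : T -> R).

Definition affine g :=
  forall s, s != [::] -> g (b s) = (size s)%:R^-1 * \sum_(x <- s) g x.

(* Affinity is only required at the barycentres [b s]; the hull is described
   dually, by half-spaces. *)
Definition hull s x :=
  forall g, affine g -> forall lo, (forall y, y \in s -> lo <= g y) -> lo <= g x.

Definition spread g s (D : R) :=
  forall x y, x \in s -> y \in s -> g x - g y <= D.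

(** The classical mesh factor of one barycentric subdivision of a simplex with [k] vertices. *)
Definition shrink k : R := 1 - k%:R^-1.

Lemma affineN g : affine g -> affine (fun x => - g x).
Proof. by move=> ag s s0; rewrite ag // sumrN mulrN. Qed.

Lemma hull_mem s x : x \in s -> hull s x.
Proof. by move=> xs g _ lo; apply. Qed.

Lemma hull_trans s s' x : (forall y, y \in s' -> hull s y) -> hull s' x -> hull s x.
Proof. by move=> h hx g ag lo glo; apply: (hx g ag) => y /h; apply. Qed.

Lemma hull_bary s : s != [::] -> hull s (b s).
Proof.
move=> s0 g ag lo glo; rewrite ag // mulrC ler_pdivlMr; last first.
  by rewrite ltr0n lt0n size_eq0.
rewrite mulr_natr -sumr_const_seq.
by rewrite !big_seq ler_sum.
Qed.

Lemma hull_le s x g hi : affine g -> hull s x ->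
  (forall y, y \in s -> g y <= hi) -> g x <= hi.
Proof.
move=> ag hx ghi; rewrite -lerN2; apply: (hx _ (affineN ag)) => y ys.
by rewrite lerN2 ghi.
Qed.

Lemma hull_eq s x g c : affine g -> hull s x ->
  (forall y, y \in s -> g y = c) -> g x = c.
Proof.
move=> ag hx gc; apply/le_anti/andP; split.
  by apply: (hull_le ag hx) => y /gc ->.
by apply: (hx _ ag) => y /gc ->.
Qed.

Lemma exists_min g s : s != [::] ->
  exists2 x, x \in s & forall y, y \in s -> g x <= g y.
Proof.
elim: s => // x [|y s] IH _.
  by exists x; rewrite ?mem_head // => y; rewrite inE => /eqP ->.
have [//|z zs minz] := IH; case: (lerP (g x) (g z)) => [le_xz | lt_zx].
  exists x => [|t]; rewrite ?mem_head // inE => /predU1P[-> //|/minz].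
  exact: le_trans.
exists z => [|t]; rewrite inE ?zs ?orbT // => /predU1P[->|/minz //].
exact: ltW.
Qed.

(** On the hull [g] is at least its minimum [g x0] over [s]. The difference [g (b s) - g x0]
    averages the differences [g y - g x0]; the one at [x0] is zero, the others are at most [D]. *)
Lemma bary_sub_le g s D x : affine g -> s != [::] -> spread g s D -> hull s x ->
  g (b s) - g x <= shrink (size s) * D.
Proof.
move=> ag s0 sD hx; have [x0 x0s minx0] := exists_min g s0.
have sz : (0 < size s)%N by rewrite lt0n size_eq0.
have szR : 0 < (size s)%:R :> R by rewrite ltr0n.
apply: (@le_trans _ _ (g (b s) - g x0)); first by rewrite lerD2l lerN2 (hx _ ag).
have -> : shrink (size s) * D = (size s)%:R^-1 * (((size s).-1)%:R * D).
  rewrite mulrA /shrink; congr (_ * _).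
  by rewrite -subn1 natrB // mulrBr mulVf ?gt_eqF // mulr1.
rewrite ag // -[g x0 in X in X <= _](mulKf (lt0r_neq0 szR)) -mulrBr.
rewrite ler_pM2l ?invr_gt0 // mulrC mulr_natr -sumr_const_seq -sumrB.
rewrite (perm_big _ (perm_to_rem x0s)) big_cons /= subrr add0r.
rewrite mulr_natl -(size_rem x0s) -sumr_const_seq.
rewrite big_seq [X in _ <= X]big_seq ler_sum // => y /mem_rem ys.
exact: sD.
Qed.

Lemma shrink_ge0 k : 0 <= shrink k.
Proof.
rewrite subr_ge0; case: k => [|k]; first by rewrite invr0 ler01.
by rewrite invf_le1 ?ltr0n // ler1n.
Qed.

(** Positivity matters: since the inverse of zero is zero, [shrink 0] is 1 while [shrink 1] is 0. *)
Lemma shrink_mono k : (0 < k)%N -> shrink k <= shrink k.+1.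
Proof. by move=> k0; rewrite lerD2l lerN2 lef_pV2 ?ler_nat // posrE ltr0n. Qed.

Lemma mem_del s i x : x \in del s i -> x \in s.
Proof. by rewrite mem_cat => /orP[/mem_take|/mem_drop]. Qed.

(** A nonzero sum has a nonzero term; following such terms down through the facets selects one tuple
    [s'] of the subdivision. *)
Lemma sd_support p s : sd b p s != 0 ->
  exists s', [/\ size s' = size s, p s' != 0, forall x, x \in s' -> hull s x &
    forall g D, affine g -> 0 <= D -> spread g s D ->
      spread g s' (shrink (size s) * D)].
Proof.
have [k] := ubnP (size s); elim: k s p => // k IH s p.
case: s => [|x s] ltsk; rewrite sdE => nz; first by exists [::].
set t := x :: s in ltsk nz *.
have [/existsP[i nzi]|] :=
    boolP [exists i : 'I_(size t), sd b (fun s' => p (b t :: s')) (del t i) != 0];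
  last first.
  rewrite negb_exists => /forallP z; case/eqP: nz.
  by apply: big1 => i _; apply/eqP; have := z i; rewrite negbK.
have szd := size_del (ltn_ord i).
have [|s' [szs' ps' hs' sp]] := IH _ _ _ nzi; first by rewrite szd.
have hs'' y : y \in s' -> hull t y.
  by move/hs'; apply: hull_trans => z /mem_del; apply: hull_mem.
exists (b t :: s'); split => //.
- by rewrite /= szs' szd.
- by move=> y; rewrite inE => /predU1P[->|/hs'' //]; apply: hull_bary.
move=> g D ag D0 spD y z.
have spN : spread (fun x => - g x) t D.
  by move=> y' z' y't z't; rewrite opprK addrC spD.
rewrite !inE => /predU1P[->|ys'] /predU1P[->|zs'].
- by rewrite subrr mulr_ge0 ?shrink_ge0.
- by apply: bary_sub_le => //; apply: hs''.
- rewrite addrC -[g y]opprK.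
  by apply: (bary_sub_le (affineN ag)) => //; apply: hs''.
(* Two points other than the new barycentre come from a facet, whose mesh factor is smaller. *)
apply: (@le_trans _ _ (shrink (size (del t i)) * D)).
  by apply: sp => // y' z' /mem_del ? /mem_del ?; apply: spD.
rewrite ler_wpM2r // szd /=; apply: shrink_mono.
by rewrite lt0n; apply/eqP => s0; move: ys'; rewrite (size0nil (_ : size s' = 0%N)) // szs' szd.
Qed.

Notation sds m := (iter m (sd b)).

Lemma sds_support m p s : sds m p s != 0 ->
  exists s', [/\ size s' = size s, p s' != 0, forall x, x \in s' -> hull s x &
    forall g D, affine g -> 0 <= D -> spread g s D ->
      spread g s' (shrink (size s) ^+ m * D)].
Proof.
elim: m s => [|m IH] s /=.
  move=> nz; exists s; split=> // [x|g D _ _]; first exact: hull_mem.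
  by rewrite expr0 mul1r.
case/sd_support=> s1 [sz1 /IH[s' [sz' nz' hs' sp']] hs1 sp1].
exists s'; split=> // [|x /hs'|g D ag D0 sD]; first by rewrite sz'.
  exact: hull_trans.
rewrite exprSr -mulrA -sz1; apply: sp' => //; last by rewrite sz1; apply: sp1.
by rewrite mulr_ge0 ?shrink_ge0.
Qed.

Lemma sdsD m p q s : sds m (fun s => p s + q s) s = sds m p s + sds m q s.
Proof. by elim: m s => //= m IH s; rewrite (eq_sd _ _ IH) sdD. Qed.

Lemma sds_cobd m p s : sds m (cobd p) s = cobd (sds m p) s.
Proof. by elim: m s => //= m IH s; rewrite (eq_sd _ _ IH) sd_cobd. Qed.

(** Mod 2 the difference is the subdivision of [p + q]; were it nonzero, [sds_support] would give a
    tuple in the hull on which [p] and [q] differ. *)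
Lemma sds_local m p q s :
  (forall s', (forall x, x \in s' -> hull s x) -> p s' = q s') ->
  sds m p s = sds m q s.
Proof.
move=> epq; apply/eqP; rewrite -subr_eq0.
have -> : - sds m q s = sds m q s by apply/eqP; rewrite eq_sym -addr_eq0 F2_addrr.
rewrite -sdsD; apply/negP => /negP /sds_support[s' [_ nz /epq e _]].
by rewrite e F2_addrr eqxx in nz.
Qed.

End Sperner.

(** * Labelled tuples and Sperner's lemma *)

Section Labels.
Variable I : eqType.

Lemma perm_del (L : seq I) i y0 : (i < size L)%N -> perm_eq L (nth y0 L i :: del L i).
Proof.
move=> iL; rewrite -[L in perm_eq L _](cat_take_drop i) (drop_nth y0) //.
by rewrite perm_catC /= perm_cons perm_catC.
Qed.

(* Sperner's door count: the [z] with [L ~ z :: vs] occurs twice in [L] unless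
   [z = y]. *)
Lemma cobd_perm_eq y (vs L : seq I) :
  uniq (y :: vs) -> {subset L <= y :: vs} ->
  cobd (fun L => (perm_eq L vs)%:R) L = (perm_eq L (y :: vs))%:R.
Proof.
move=> /= /andP[ynvs uvs] Lsub.
pose G z : 'F_2 := (perm_eq L (z :: vs))%:R.
have -> : cobd (fun L => (perm_eq L vs)%:R) L = \sum_(z <- L) G z.
  rewrite (big_nth y) big_mkord; apply: eq_bigr => i _.
  by rewrite /G (permPl (perm_del y (ltn_ord i))) perm_cons.
have [/hasP[z zL Lz]|/hasPn nL] := boolP (has (fun z => perm_eq L (z :: vs)) L).
  (* Over [z :: vs] the sum is 1 plus the indicator of [z \in vs], so it is 1 when [z = y] and 0
     otherwise. *)
  rewrite (perm_big _ Lz) big_cons /G Lz.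
  have -> : \sum_(w <- vs) (perm_eq L (w :: vs))%:R = (z \in vs)%:R :> 'F_2.
    have E w : perm_eq L (w :: vs) = (w == z).
      apply/idP/eqP => [|-> //]; rewrite (permPl Lz) => /permP/(_ (pred1 w)) /=.
      by rewrite eqxx; case: eqP => // _ /addIn.
    under eq_bigr => w _ do rewrite E.
    rewrite -count_uniq_mem // -sum1_count -natr_sum; congr (_%:R).
    by rewrite [RHS]big_mkcond.
  have := Lsub _ zL; rewrite inE (permPl Lz).
  have -> : perm_eq (z :: vs) (y :: vs) = (z == y).
    apply/idP/eqP => [/permP/(_ (pred1 y))/=|-> //].
    by rewrite eqxx; case: eqP => // _ /addIn.
  case: eqP => [-> _|_ /= ->]; first by rewrite (negPf ynvs) [LHS]addr0.
  exact: F2_addrr.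
rewrite big_seq big1 => [|z /nL /negPf]; last by rewrite /G => ->.
case: (boolP (perm_eq _ _)) => // Ly; have := mem_head y vs.
by rewrite -(perm_mem Ly) => /nL; rewrite Ly.
Qed.

End Labels.

Lemma del_map (S T : Type) (h : S -> T) s i : del (map h s) i = map h (del s i).
Proof. by rewrite /del map_cat map_take map_drop. Qed.

Section SpernerLemma.
Variables (R : realFieldType) (T I : eqType) (b : seq T -> T).
Variables (g : I -> T -> R) (e : I -> T) (l : T -> I) (vs0 : seq I).
Hypothesis aff_g : forall i, affine b (g i).
Hypothesis g_e : forall i j, g i (e j) = (i == j)%:R.
Hypothesis l_gt0 : forall x, hull R b (map e vs0) x -> 0 < g (l x) x.

Let sub_hull vs x : {subset vs <= vs0} -> hull R b (map e vs) x -> hull R b (map e vs0) x.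
Proof.
move=> sub; apply: hull_trans => y /mapP[i ivs ->].
by apply: hull_mem; rewrite map_f ?sub.
Qed.

(** Sperner's boundary condition: on the face spanned by [vs] all coordinates outside [vs] vanish,
    while the coordinate named by the label is positive. *)
Let label_mem vs x : {subset vs <= vs0} -> hull R b (map e vs) x -> l x \in vs.
Proof.
move=> sub hx; have := l_gt0 (sub_hull sub hx); apply: contraTT => lvs.
rewrite (hull_eq (aff_g _) hx (c := 0)) ?ltxx // => y /mapP[i ivs ->].
by rewrite g_e; case: eqP => // eqi; rewrite eqi ivs in lvs.
Qed.

(** The number of fully labelled tuples is odd. Inside the hull their indicator is the coboundary of
    the indicator for [vs], so the count moves to the facets; the facet opposite [y] contributes 1
    by induction. *)
Lemma sperner_parity m vs : uniq vs -> {subset vs <= vs0} ->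
  iter m (sd b) (fun s => (perm_eq (map l s) vs)%:R) (map e vs) = 1.
Proof.
elim: vs => [|y vs IH] uvs sub; first by elim: m.
pose q := fun s => (perm_eq (map l s) vs)%:R : 'F_2.
rewrite (@sds_local R _ b m _ (cobd q)); last first.
  move=> s' hs'; rewrite -(cobd_perm_eq uvs).
    by rewrite /cobd size_map; apply: eq_bigr => i _; rewrite del_map.
  by move=> _ /mapP[x /hs' hx ->]; apply: label_mem.
rewrite sds_cobd [map _ _]/= cobd_cons IH; last 2 first.
- by case/andP: uvs.
- by move=> z zvs; rewrite sub // inE zvs orbT.
(* Every other facet omits the vertex [nth y vs i], and none of its points can carry that label. *)
rewrite /cobd big1 ?addr0 // => i _; apply/eqP/negP => /negP.
case/(@sds_support R) => s' [_ + hs' _].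
rewrite /q; case: (boolP (perm_eq _ _)) => // lvs _.
have lti : (i < size vs)%N by rewrite -(size_map e).
have : nth y vs i \in map l s' by rewrite (perm_mem lvs) mem_nth.
case/mapP=> x /hs'; rewrite del_map -[_ :: _]/(map e (y :: del vs i)) => hx lx.
have : l x \in y :: del vs i.
  by apply: label_mem hx => z; rewrite inE => /predU1P[->|/mem_del zvs];
    rewrite sub // inE ?eqxx ?zvs ?orbT.
rewrite -lx inE => /predU1P[eqy|ind].
  by move: uvs => /=; rewrite -eqy mem_nth.
by move: uvs; rewrite cons_uniq => /andP[_]; rewrite (perm_uniq (perm_del y lti)) /= ind.
Qed.

Lemma sperner m : uniq vs0 -> exists s,
  [/\ perm_eq (map l s) vs0, forall x, x \in s -> hull R b (map e vs0) x &
   forall h D, affine b h -> 0 <= D -> spread h (map e vs0) D ->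
      spread h s (shrink R (size vs0) ^+ m * D)].
Proof.
move=> uvs; have nz : iter m (sd b) (fun s => (perm_eq (map l s) vs0)%:R) (map e vs0) != 0.
  by rewrite sperner_parity ?oner_eq0.
have [s [_ ps hs sp]] := @sds_support R _ _ _ _ _ nz.
exists s; split=> // [|h D ah D0 shD]; last by rewrite -(size_map e); apply: sp.
by move: ps; case: (perm_eq _ _) => //; rewrite eqxx.
Qed.

End SpernerLemma.

Lemma exists_expr_lt (R : archiRealFieldType) (z d : R) :
  `|z| < 1 -> 0 < d -> exists k, z ^+ k < d.
Proof.
move=> /cvg_expr zk d0; have /cvgrPdist_lt/(_ d d0)[k _ /(_ k (leqnn k))] /= := zk.
by rewrite sub0r normrN => /ltr_normlW zkd; exists k.
Qed.

(** * Colouring of Euclidean space by separated cubes *)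

Section Colouring.
Variable m : nat.

Lemma exists_colour (a : 'I_m -> int) :
  exists k : 'I_m.+1, forall j, (a j %% m.+1)%Z != k.
Proof.
pose r j : 'I_m.+1 := inord `|(a j %% m.+1)%Z|.
have /existsP[k /negP kr] : [exists k, k \notin codom r].
  apply: contraT; rewrite negb_exists => /forallP all_r.
  have : (#|'I_m.+1| <= #|codom r|)%N.
    by apply: subset_leq_card; apply/fintype.subsetP => k _; have := all_r k; rewrite negbK.
  move=> /leq_trans/(_ (card_size _)).
  by rewrite size_map -cardE !card_ord ltnn.
exists k => j; apply/eqP => eqk; apply: kr; apply/codomP; exists j.
by apply/val_inj; rewrite /r eqk /= inordK.
Qed.

(* With [a] the integer part of a rescaled coordinate and [k] a colour, the
   quotient below indexes the cubes of colour [k]. *)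
Lemma divz_eq_close (a b k : int) : `|a - b| <= 1 ->
  ((a - k)%R %% m.+1)%Z != 0 -> ((b - k)%R %% m.+1)%Z != 0 ->
  ((a - k)%R %/ m.+1)%Z = ((b - k)%R %/ m.+1)%Z.
Proof.
move=> ab; have := divz_eq (a - k)%R m.+1; have := divz_eq (b - k)%R m.+1.
have := ltz_pmod (a - k) (ltn0Sn m : 0 < m.+1%:Z :> int).
have := ltz_pmod (b - k) (ltn0Sn m : 0 < m.+1%:Z :> int).
have := modz_ge0 (a - k) (isT : m.+1%:Z != 0).
have := modz_ge0 (b - k) (isT : m.+1%:Z != 0).
set ra := (_ %% _)%Z; set rb := (_ %% _)%Z.
set qa := (_ %/ _)%Z; set qb := (_ %/ _)%Z.
(* Consecutive integers have different quotients only if the larger one has residue zero. *)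
nia.
Qed.

(** Bounds the cubes: with [dist_of_round], points of one cube differ by less than [m + 1] mesh
    widths in each coordinate. *)
Lemma divz_eq_far (a b k : int) :
  ((a - k)%R %/ m.+1)%Z = ((b - k)%R %/ m.+1)%Z -> `|a - b| <= m.
Proof.
have := divz_eq (a - k)%R m.+1; have := divz_eq (b - k)%R m.+1.
have := ltz_pmod (a - k) (ltn0Sn m : 0 < m.+1%:Z :> int).
have := ltz_pmod (b - k) (ltn0Sn m : 0 < m.+1%:Z :> int).
have := modz_ge0 (a - k) (isT : m.+1%:Z != 0).
have := modz_ge0 (b - k) (isT : m.+1%:Z != 0).
set ra := (_ %% _)%Z; set rb := (_ %% _)%Z.
set qa := (_ %/ _)%Z; set qb := (_ %/ _)%Z.
move=> h1 h2 h3 h4 h5 h6 E; move: h5 h6; rewrite E; lia.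
Qed.

End Colouring.

Section Rounding.
Variables (R : realFieldType) (A B M w x y : R).
Hypothesis w0 : 0 < w.
Hypothesis xA : A * w <= x < (A + 1) * w.
Hypothesis yB : B * w <= y < (B + 1) * w.

Lemma dist_of_round : `|A - B| <= M -> `|x - y| < (M + 1) * w.
Proof.
have [/andP[xl xu] /andP[yl yu]] := (xA, yB).
rewrite ler_norml ltr_norml => /andP[].
rewrite -(ler_pM2r w0) -(ler_pM2r w0 (A - B)) => a1 a2.
by apply/andP; split; lra.
Qed.

(** For integers this bound says that the distance is at most 1, as [divz_eq_close] requires. *)
Lemma round_of_dist : `|x - y| < w -> `|A - B| < 2.
Proof.
have [/andP[xl xu] /andP[yl yu]] := (xA, yB).
rewrite !ltr_norml -(ltr_pM2r w0 _ (A - B)) -(ltr_pM2r w0 (A - B)).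
by move=> /andP[a1 a2]; apply/andP; split; lra.
Qed.

End Rounding.

(** * A simplex with [m + 2] vertices has no uniform embedding into [m] coordinates *)

Section NoEmbedding.
Variables (R : realType) (n : nat).
Implicit Types (x y : 'rV[R]_n) (vs : seq 'I_n).

Definition simplex vs x :=
  [/\ forall i, 0 <= x ord0 i, \sum_i x ord0 i = 1 &
      forall i, i \notin vs -> x ord0 i = 0].

Definition bary (s : seq 'rV[R]_n) := (size s)%:R^-1 *: \sum_(x <- s) x.

Lemma affine_coord i : affine bary (fun x => x ord0 i).
Proof. by move=> s _; rewrite mxE summxE. Qed.

Lemma affine_total : affine bary (fun x => \sum_i x ord0 i).
Proof.
move=> s _; rewrite exchange_big mulr_sumr /=; apply: eq_bigr => i _.
by rewrite mxE summxE.
Qed.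

Lemma simplex_hull vs x :
  hull R bary (map (fun i => delta_mx ord0 i) vs) x -> simplex vs x.
Proof.
move=> hx; split=> [i||i ivs].
- apply: (hx _ (affine_coord i)) => y /mapP[j _ ->].
  by rewrite mxE ler0n.
- apply: (hull_eq affine_total hx) => y /mapP[j _ ->].
  rewrite (bigD1 j) //= mxE !eqxx big1 ?addr0 // => i /negPf ij.
  by rewrite mxE ij.
- apply: (hull_eq (affine_coord i) hx) => y /mapP[j jvs ->].
  by rewrite mxE eqxx; case: eqP => // eqij; rewrite eqij jvs in ivs.
Qed.

Lemma simplex_large_coord vs x : simplex vs x -> (0 < size vs)%N -> uniq vs ->
  exists2 i, i \in vs & (size vs)%:R^-1 <= x ord0 i.
Proof.
move=> [x0 x1 xvs] vs0 uvs; apply/hasP; apply: contraT => /hasPn small.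
suff : \sum_i x ord0 i < 1 by rewrite x1 ltxx.
rewrite (bigID (mem vs)) /= [X in _ + X]big1 // addr0 -big_uniq //=.
apply: (@lt_le_trans _ _ (\sum_(i <- vs) (size vs)%:R^-1)); last first.
  by rewrite sumr_const_seq -[_ *+ _]mulr_natr mulVf // pnatr_eq0 -lt0n.
rewrite !big_seq; apply: ltr_sum => [|i /small]; last by rewrite -ltNge.
by case: vs vs0 {uvs xvs small} => // i vs _; apply/hasP; exists i; rewrite mem_head.
Qed.

Variables (m : nat) (vs : seq 'I_n) (h : 'I_m -> 'rV[R]_n -> R).
Hypotheses (uvs : uniq vs) (szvs : size vs = m.+2).

Lemma no_uniform_embedding :
  (forall e : R, 0 < e -> exists2 d : R, 0 < d & forall x y, simplex vs x -> simplex vs y ->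
     (forall i, `|x ord0 i - y ord0 i| < d) -> forall j, `|h j x - h j y| < e) ->
  (forall e : R, 0 < e -> exists2 d : R, 0 < d & forall x y, simplex vs x -> simplex vs y ->
     (forall j, `|h j x - h j y| < d) -> forall i, `|x ord0 i - y ord0 i| < e) ->
  False.
Proof.
move=> ucont uinv.
(* Every point of the simplex has a coordinate of size at least [1 / (m + 2)], so a set of smaller
   diameter misses the opposite facet. *)
have [|r r0 rP] := uinv (m.+2%:R^-1); first by rewrite invr_gt0 ltr0n.
have m1 : 0 < m.+1%:R :> R by rewrite ltr0n.
(* The grid has mesh [r / (m + 1)], which makes the cubes smaller than [r]. *)
have [|d d0 dP] := ucont (r / m.+1%:R); first by rewrite divr_gt0.
pose a x j : int := Num.floor (h j x / (r / m.+1%:R)).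
(* The default [ord0] is never taken, by [exists_colour]. *)
pose colour x : 'I_m.+1 :=
  odflt ord0 [pick k : 'I_m.+1 | [forall j, (a x j %% m.+1)%Z != k]].
have colourP x j : ((a x j - (colour x)%:Z)%R %% m.+1)%Z != 0.
  suff : (a x j %% m.+1)%Z != colour x.
    apply: contra => /eqP a0; have := divz_eq (a x j - (colour x)%:Z)%R m.+1.
    rewrite a0 addr0; move: (_ %/ _)%Z => q aq.
    have -> : a x j = q * m.+1 + colour x by rewrite -aq subrK.
    by rewrite modzMDl modz_small //= ltz_nat ltn_ord.
  rewrite /colour; case: pickP => [k /forallP //|].
  have [k kP] := exists_colour (a x).
  by move/(_ k)/negP; case; apply/forallP.
pose cell x : {ffun 'I_m -> int} := [ffun j => ((a x j - (colour x)%:Z)%R %/ m.+1)%Z].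
have rm0 : 0 < r / m.+1%:R by rewrite divr_gt0.
have aP x j : (a x j)%:~R * (r / m.+1%:R) <= h j x < ((a x j)%:~R + 1) * (r / m.+1%:R).
  have := floor_itv (h j x / (r / m.+1%:R)).
  by rewrite ler_pdivlMr // ltr_pdivrMr // intrD.
have cell_small x y : colour x = colour y -> cell x = cell y ->
    forall j, `|h j x - h j y| < r.
  move=> exy /ffunP cxy j; have := cxy j; rewrite !ffunE -exy => /divz_eq_far.
  rewrite -(ler_int R) intr_norm intrB => axy.
  have -> : r = (m%:R + 1) * (r / m.+1%:R).
    by rewrite -natr1 mulrCA mulfV ?mulr1 // natr1 gt_eqF.
  exact: dist_of_round rm0 (aP x j) (aP y j) axy.
have close_cell x y : (forall j, `|h j x - h j y| < r / m.+1%:R) ->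
    colour x = colour y -> cell x = cell y.
  move=> hxy exy; apply/ffunP => j; rewrite !ffunE exy; apply: divz_eq_close => //.
    suff : `|a x j - a y j| < 2 by lia.
    rewrite -(ltr_int R) intr_norm intrB.
    exact: round_of_dist rm0 (aP x j) (aP y j) (hxy j).
  by rewrite -exy.
have /hasP[i0 _ _] : has predT vs by rewrite has_predT szvs.
(* The label depends on the colour and the cube only, so points of one cube share it; positivity on
   the whole cube says that the facet opposite the label is missed. *)
pose lab k c := odflt i0
  [pick i in vs | `[< forall y, simplex vs y -> colour y = k -> cell y = c -> 0 < y ord0 i >]].
pose l x := lab (colour x) (cell x).
have l_gt0 x : hull R bary (map (fun i => delta_mx ord0 i) vs) x -> 0 < x ord0 (l x).
  move=> /simplex_hull sx; rewrite /l /lab; case: pickP => [i /andP[_ /asboolP]|].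
    exact.
  have [||i ivs xi] := simplex_large_coord sx; rewrite ?szvs //.
  move/(_ i); rewrite ivs /= => /negP; case; apply/asboolP => y sy exy cxy.
  have := rP x y sx sy (cell_small x y (esym exy) (esym cxy)) i.
  by rewrite -szvs ltr_norml => /andP[_]; lra.
have [M Md] : exists M, shrink R m.+2 ^+ M < d.
  apply: exists_expr_lt => //; rewrite ger0_norm ?shrink_ge0 //.
  by rewrite ltrBlDr ltrDl invr_gt0 ltr0n.
have [|s [ls hs ss]] := sperner affine_coord _ l_gt0 M uvs.
  by move=> i j; rewrite mxE eqxx.
have ds x y : x \in s -> y \in s -> forall i, `|x ord0 i - y ord0 i| < d.
  move=> xs ys i; have {}ss := ss _ 1 (affine_coord i) ler01.
  rewrite szvs mulr1 in ss.
  (* The coordinates of the vertices are 0 or 1, so the initial spread is 1. *)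
  have sp : spread (fun x : 'rV[R]_n => x ord0 i) s (shrink R m.+2 ^+ M).
    apply: ss => _ _ /mapP[j _ ->] /mapP[k _ ->]; rewrite !mxE.
    by do 2![case: (_ && _)]; rewrite ?mulr0n ?mulr1n; lra.
  have := sp _ _ xs ys; have := sp _ _ ys xs; rewrite ltr_norml; lra.
have /uniqPn : ~~ uniq (map colour s).
  apply/negP => /card_uniqP ec; have := max_card (mem (map colour s)).
  by rewrite ec card_ord size_map -(size_map l) (perm_size ls) szvs ltnn.
case/(_ ord0) => i [j [ij]]; rewrite size_map => js.
have is_ := ltn_trans ij js.
rewrite !(nth_map 0) //; set x := nth 0 s i; set y := nth 0 s j => cxy.
have [xs ys] : x \in s /\ y \in s by rewrite !mem_nth.
have lxy : l x = l y.
  rewrite /l -cxy (close_cell x y) // => k; apply: dP; last exact: ds.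
    exact: simplex_hull (hs _ xs).
  exact: simplex_hull (hs _ ys).
have : uniq (map l s) by rewrite (perm_uniq ls).
move/(nth_uniq i0) => /(_ i j); rewrite !size_map => /(_ is_ js).
by rewrite !(nth_map 0) // -/x -/y lxy eqxx (ltn_eqF ij).
Qed.

End NoEmbedding.

(** * The boundary operator and the Euler-Poincare formula *)

Section Euler.
Variables (R : realType) (n : nat) (L : {set {set 'I_n}}).
Hypothesis L_sub : forall s t : {set 'I_n},
  s \in L -> t != finset.set0 -> t \subset s -> t \in L.
Implicit Types (s t r : {set 'I_n}) (x y : 'I_n).

Definition incidence s x : R := (-1) ^+ #|finset (fun y : 'I_n => (y \in s) && (y < x)%N)|.

Lemma incidenceD1 s x y : x \in s ->
  incidence s y = (-1) ^+ (x < y)%N * incidence (s :\ x) y.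
Proof.
move=> xs; rewrite /incidence -exprD (cardsD1 x) !inE xs; congr (_ ^+ (_ + _)).
by apply: eq_card => z; rewrite !inE andbA.
Qed.

(** Deleting a vertex flips the signs of the larger vertices only, so exactly one of the two signs
    changes. *)
Lemma incidence_swap s x y : x \in s -> y \in s -> x != y ->
  incidence s x * incidence (s :\ x) y = - (incidence s y * incidence (s :\ y) x).
Proof.
move=> xs ys; rewrite (incidenceD1 y xs) (incidenceD1 x ys) -val_eqE.
by case: ltngtP => //= _ _; rewrite expr0 expr1; ring.
Qed.

Lemma facesD1 s k x : s \in faces L k.+1 -> x \in s -> s :\ x \in faces L k.
Proof.
rewrite !inE => /andP[sL /eqP sk] xs.
have -> : #|s :\ x| = k by move: sk; rewrite (cardsD1 x) xs; case.
rewrite eqxx andbT; case: eqVneq => //= sx0.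
case/orP: sL => [/eqP s0|sL]; first by rewrite s0 inE in xs.
by apply: L_sub sL sx0 _; rewrite subD1set.
Qed.

Lemma mulmx_bdry k : bdry R L k.+1 *m bdry R L k = 0.
Proof.
apply/matrixP => i l; rewrite !mxE.
set s : {set 'I_n} := enum_val i; set t : {set 'I_n} := enum_val l.
have sF : s \in faces L k.+1 by apply: enum_valP.
pose D r : R := \sum_(y in r | r :\ y == t) incidence r y.
have -> : \sum_j bdry R L k.+1 i j * bdry R L k j l =
    \sum_(r in faces L k) (\sum_(x in s | s :\ x == r) incidence s x) * D r.
  by rewrite [RHS]big_enum_val; apply: eq_bigr => j _; rewrite !mxE.
have -> : \sum_(r in faces L k) (\sum_(x in s | s :\ x == r) incidence s x) * D r =
    \sum_(x in s) incidence s x * D (s :\ x).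
  under eq_bigr => r _ do rewrite mulr_suml.
  rewrite (exchange_big_dep (mem s)) /=; last by move=> r x _ /andP[].
  apply: eq_bigr => x xs; rewrite (big_pred1 (s :\ x)) // => r.
  rewrite /= eq_sym xs /=; case: eqVneq => [->|_]; last by rewrite andbF.
  by rewrite facesD1.
(* The sum runs over ordered pairs of deleted vertices and is antisymmetric, hence equal to its own
   negative. *)
pose E x y := if [&& x \in s, y \in s, x != y & s :\ x :\ y == t]
  then incidence s x * incidence (s :\ x) y else 0.
have -> : \sum_(x in s) incidence s x * D (s :\ x) = \sum_x \sum_y E x y.
  rewrite big_mkcond; apply: eq_bigr => x _; case: ifP => xs; last first.
    by rewrite big1 // => y _; rewrite /E xs.
  rewrite mulr_sumr big_mkcond; apply: eq_bigr => y _.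
  by rewrite /E xs finset.in_setD1 (eq_sym y) -andbA andbCA.
have EN x y : E x y = - E y x.
  have C : [&& y \in s, x \in s, y != x & s :\ y :\ x == t] =
           [&& x \in s, y \in s, x != y & s :\ x :\ y == t].
    by rewrite andbCA (eq_sym y) !finset.setDDl [_ [set y] _]finset.setUC.
  by rewrite /E C; case: ifP => [/and4P[xs ys xy _]|_]; rewrite ?oppr0 // incidence_swap.
apply/eqP; rewrite -eqNr; apply/eqP; rewrite [RHS]exchange_big -sumrN /=.
apply: eq_bigr => x _; rewrite -sumrN; apply: eq_bigr => y _.
by rewrite [RHS]EN.
Qed.

(** The truncated subtractions are exact, since [mulmx_bdry] bounds the sum of the two ranks by the
    number of faces. *)
Lemma red_bettiE k : (red_betti R L k)%:Z =
  #|faces L k|%:Z - (\rank (bdry R L k))%:Z - (\rank (bdry R L k.+1))%:Z.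
Proof.
have h : (\rank (bdry R L k.+1) + \rank (bdry R L k) <= #|faces L k|)%N.
  exact: mulmx0_rank_max (mulmx_bdry k).
by rewrite /red_betti; lia.
Qed.

Lemma bdry0 : bdry R L 0 = 0.
Proof.
apply/matrixP => i j; rewrite !mxE /= big1 // => x /andP[xi _].
have := enum_valP i; rewrite !inE => /andP[_ /eqP/cards0_eq i0].
by rewrite i0 inE in xi.
Qed.

Lemma euler_poincare N : (forall s, s \in L -> (#|s| <= N)%N) ->
  \sum_(k < N.+1) (-1) ^+ k * (red_betti R L k)%:Z =
  \sum_(k < N.+1) (-1) ^+ k * #|faces L k|%:Z.
Proof.
move=> dimL.
(* The ranks telescope and leave only the last one, which is zero at [N + 1] because there are no
   faces of that size. *)
have partial M : \sum_(k < M) (-1) ^+ k * (red_betti R L k)%:Z =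
    \sum_(k < M) (-1) ^+ k * #|faces L k|%:Z + (-1) ^+ M * (\rank (bdry R L M))%:Z.
  elim: M => [|M IH]; first by rewrite !big_ord0 bdry0 mxrank0 mulr0.
  by rewrite !big_ord_recr /= IH red_bettiE exprS; ring.
rewrite partial [X in _ + _ * X](_ : _ = 0) ?mulr0 ?addr0 //.
suff : (\rank (bdry R L N.+1) <= 0)%N by rewrite leqn0 => /eqP ->.
apply: leq_trans (rank_leq_row _) _; rewrite leqn0 cards_eq0.
apply/eqP/finset.setP => s; rewrite !inE.
case: eqVneq => [->|_] /=; first by rewrite cards0.
by apply/negP => /andP[/dimL + /eqP sN]; rewrite sN ltnn.
Qed.

End Euler.

(** * Exchanging [u] and [v] between their links *)

Section Exchange.
Variables (n : nat) (K : {set {set 'I_n}}) (P : pred 'I_n).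
Hypothesis cK : simplicial_complex K.
Implicit Types (u v : 'I_n) (s : {set 'I_n}).

Lemma mem_Lk v s : (s \in Lk K v) = [&& s != finset.set0, v \notin s & v |: s \in K].
Proof.
have [K0 [Ksub _]] := cK.
rewrite inE; apply/andP/and3P => [[sK /existsP[r /and3P[]]]|[s0 vs vsK]].
  rewrite inE => /andP[rK vr] sr vs; split=> //; first exact: K0.
  apply: Ksub rK _ _; first by apply/set0Pn; exists v; rewrite !inE eqxx.
  by rewrite finset.subUset finset.sub1set vr.
have sub : s \subset v |: s by rewrite finset.subsetUr.
split; first exact: Ksub vsK s0 sub.
by apply/existsP; exists (v |: s); rewrite inE vsK !inE eqxx sub.
Qed.

Lemma Lk_sub v s (t : {set 'I_n}) :
  s \in Lk K v -> t != finset.set0 -> t \subset s -> t \in Lk K v.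
Proof.
have [_ [Ksub _]] := cK.
rewrite !mem_Lk => /and3P[s0 vs vsK] t0 ts; rewrite t0 /=; apply/andP; split.
  by apply: contra vs; apply/fintype.subsetP.
apply: Ksub vsK _ (finset.setUS _ ts).
by apply/set0Pn; exists v; rewrite !inE eqxx.
Qed.

(** With [P] the set of other vertices below, this is the lower link of [v] when [v] lies above [u];
    [link_below] is the one when [v] lies below [u]. *)
Definition link_above v u := finset (fun s => (s \in Lk K v) &&
  [forall x in s, (x == u) || P x]).
Definition link_below v u := finset (fun s => (s \in Lk K v) &&
  [forall x in s, (x != u) && P x]).
Definition link_through v u k := finset (fun s => (s \in faces (link_above v u) k) && (u \in s)).

Lemma mem_faces (L : {set {set 'I_n}}) k s :
  (s \in faces L k) = ((s == finset.set0) || (s \in L)) && (#|s| == k).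
Proof. by rewrite finset.in_set finset.in_setU1. Qed.

Lemma card_link_above v u k : P u = false ->
  #|faces (link_above v u) k| = (#|faces (link_below v u) k| + #|link_through v u k|)%N.
Proof.
move=> Pu; rewrite -[LHS](cardsID (finset (fun s : {set 'I_n} => u \in s))) addnC.
congr (_ + _)%N; last first.
  by apply: eq_card => s; rewrite !inE.
apply: eq_card => s; rewrite !inE; have [us|us] /= := boolP (u \in s).
  have [s0|_] := eqVneq s finset.set0; first by rewrite s0 inE in us.
  rewrite /= (_ : [forall x in s, (x != u) && P x] = false) ?andbF //.
  by apply/negP => /forall_inP/(_ u us); rewrite eqxx.
congr ((_ || (_ && _)) && _); apply: eq_forallb => x.
by case: (eqVneq x u) => [->|_]; rewrite ?(negPf us).
Qed.

(** The exchange [h] preserves the joined simplex, [u |: h s = v |: s]; hence [h s] lies in the link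
    of [u], and removing [v] from that simplex recovers [s]. *)
Lemma leq_link_through u v k : u != v -> (#|link_through v u k| <= #|link_through u v k|)%N.
Proof.
move=> uv; pose h s : {set 'I_n} := v |: s :\ u.
have thr s : s \in link_through v u k ->
    [/\ v \notin s, v |: s \in K, [forall x in s, (x == u) || P x], #|s| = k & u \in s].
  rewrite finset.in_set mem_faces => /andP[+ us]; case: eqVneq => [s0|_].
    by move: us; rewrite s0 inE.
  by rewrite finset.in_set mem_Lk => /andP[/andP[/and3P[_ vs vsK] sP] /eqP sk].
have hK s : v \notin s -> u \in s -> u |: h s = v |: s.
  by move=> _ us; rewrite /h finset.setUCA finset.setD1K.
have hinj : {in link_through v u k &, injective h}.
  move=> s r /thr[vs _ _ _ us] /thr[vr _ _ _ ur] hsr.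
  rewrite -(finset.setU1K vs) -(finset.setU1K vr) -(hK s) // -(hK r) //.
  by rewrite hsr.
rewrite -(card_in_imset hinj); apply: subset_leq_card.
apply/fintype.subsetP => _ /imsetP[s /thr[vs vsK sP sk us] ->].
have vh : v \in h s by rewrite !inE eqxx.
have uh : u \notin h s by rewrite !inE eqxx orbF.
have hk : #|h s| = k.
  by rewrite /h cardsU1 !inE (negPf vs) andbF /= -sk [RHS](cardsD1 u) us.
rewrite finset.in_set vh andbT mem_faces hk eqxx andbT; apply/orP; right.
rewrite finset.in_set mem_Lk uh hK // vsK andbT; apply/andP; split.
  by rewrite andbT; apply/set0Pn; exists v.
apply/forall_inP => x; rewrite !inE => /predU1P[->|/andP[xu xs]]; first by rewrite eqxx.
by have /forall_inP/(_ x xs) := sP; rewrite (negPf xu) => /= ->; rewrite orbT.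
Qed.

Lemma card_link_through u v k : u != v -> #|link_through v u k| = #|link_through u v k|.
Proof.
by move=> uv; apply/eqP; rewrite eqn_leq !leq_link_through // eq_sym.
Qed.

End Exchange.

(** * Vertex comparisons over time and lower links *)

Lemma noncrossing_le (R : realType) n (f : R -> 'I_n -> R) (a b : R) x y :
  Defs.family f -> 0 <= a -> b <= 1 ->
  (forall t, a <= t <= b -> f t x != f t y) ->
  forall t t', a <= t <= b -> a <= t' <= b -> (f t x <= f t y) = (f t' x <= f t' y).
Proof.
move=> cf a0 b1 ne.
suff le t t' : a <= t <= b -> a <= t' <= b -> t <= t' ->
    (f t x <= f t y) = (f t' x <= f t' y).
  by move=> t t' ht ht'; case/orP: (le_total t t') => tt; [|symmetry]; apply: le.
move=> /andP[at_ tb] /andP[at' tb'] tt'.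
pose g s := f s x - f s y.
have sub : (`[t, t'] `<=` `[0, 1])%classic.
  move=> s; rewrite /= !in_itv /= => /andP[ts st'].
  by rewrite (le_trans (le_trans a0 at_)) // (le_trans st') // (le_trans tb').
have cg1 : {within `[0, 1]%classic, continuous g}%classic.
  by move=> s; apply: cvgB; apply: cf.
have cg := continuous_subspaceW sub cg1.
(* By the intermediate value theorem a change of sign of [g] would produce a crossing. *)
have nz : ~~ (Num.min (g t) (g t') <= 0 <= Num.max (g t) (g t')).
  apply/negP => /(IVT tt' cg)[s]; rewrite in_itv /= => /andP[ts st'] /eqP.
  rewrite subr_eq0; apply/negP; apply: ne.
  by rewrite (le_trans at_ ts) (le_trans st' tb').
apply/idP/idP; rewrite -![f _ x <= _]subr_le0 -/(g t) -/(g t') => le0;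
  apply: contraNT nz; rewrite -ltNge ge_min le_max le0 => /ltW ->; by rewrite ?orbT.
Qed.

Section LowerLink.
Variables (R : realType) (n : nat) (K : {set {set 'I_n}}) (f : R -> 'I_n -> R).
Hypothesis cK : simplicial_complex K.

Lemma mem_lower_link t w s : (s \in lower_link K f t w) =
  (s \in Lk K w) && [forall x in s, f t x <= f t w].
Proof. by rewrite finset.in_set. Qed.

Lemma lower_link_sub t w (s r : {set 'I_n}) :
  s \in lower_link K f t w -> r != finset.set0 -> r \subset s ->
  r \in lower_link K f t w.
Proof.
rewrite !mem_lower_link => /andP[sLk /forall_inP sw] r0 /fintype.subsetP rs.
rewrite (Lk_sub cK sLk) //=; last exact/fintype.subsetP.
by apply/forall_inP => x /rs; apply: sw.
Qed.

(** Faces of the link of [w] avoid [w], so the value of [C] at [w] is irrelevant. *)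
Lemma lower_linkE t w (C : pred 'I_n) :
  (forall x, x != w -> (f t x <= f t w) = C x) ->
  lower_link K f t w = finset (fun s => (s \in Lk K w) && [forall x in s, C x]).
Proof.
move=> fC; apply/finset.setP => s; rewrite mem_lower_link finset.in_set.
have [sLk|//] := boolP (s \in Lk K w).
apply: eq_forallb => x; have [xs|//] := boolP (x \in s); rewrite /= fC //.
by move: sLk; rewrite mem_Lk // => /and3P[_ ws _]; apply: contraNneq ws => <-.
Qed.

End LowerLink.

(** * Compactness: from continuous to uniform embeddings *)

Local Open Scope classical_set_scope.
Local Open Scope ring_scope.

Definition cont_on (R : realType) (X : topologicalType) (A : set X) (f : X -> R) :=
  forall x, A x -> forall e, 0 < e -> \forall y \near x, A y -> `|f x - f y| < e.

Lemma within_cont_on (R : realType) n k (A : set 'rV[R]_n) (F : 'rV[R]_n -> 'rV[R]_k) j :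
  {within A, continuous F} -> cont_on A (fun x => F x ord0 j).
Proof.
move=> /subspace_continuousP cF x Ax e e0.
have /cvgrPdist_lt/(_ e e0) : (fun x => F x ord0 j) @ within A (nbhs x) --> F x ord0 j.
  apply: (@cvg_comp _ _ _ F (fun y => y ord0 j) _ (nbhs (F x))); first exact: cF.
  exact: coord_continuous.
exact.
Qed.

Section Uniform.
Variables (R : realType) (X : topologicalType) (K : set X) (a b : nat).
Variables (f : 'I_a -> X -> R) (g : 'I_b -> X -> R).

(** Covers both uniform continuity of a map and that of its inverse. It suffices to find a bound [d]
    near each pair of points of [K], as [K * K] is compact. *)
Lemma uniform_on_compact : compact K ->
  (forall i, cont_on K (f i)) -> (forall j, cont_on K (g j)) ->
  (forall x y, K x -> K y -> (forall i, f i x = f i y) -> forall j, g j x = g j y) ->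
  forall e : R, 0 < e -> exists2 d : R, 0 < d & forall x y, K x -> K y ->
    (forall i, `|f i x - f i y| < d) -> forall j, `|g j x - g j y| < e.
Proof.
move=> cK cf cg fg e e0.
have /compact_near_coveringP cov := compact_setX cK cK.
pose P (d : R) (z : X * X) := K z.1 -> K z.2 ->
  (forall i, `|f i z.1 - f i z.2| < d) -> forall j, `|g j z.1 - g j z.2| < e.
have near2 c (h : 'I_c -> X -> R) (x y : X) (r : R) : 0 < r ->
    (forall i, cont_on K (h i)) -> K x -> K y ->
    \forall z \near (x, y), K z.1 -> K z.2 ->
      forall i, `|h i x - h i z.1| < r /\ `|h i y - h i z.2| < r.
  move=> r0 ch Kx Ky.
  have nx : \forall x' \near x, forall i, K x' -> `|h i x - h i x'| < r.
    by apply: filter_forall => i; apply: ch.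
  have ny : \forall x' \near y, forall i, K x' -> `|h i y - h i x'| < r.
    by apply: filter_forall => i; apply: ch.
  have nx' : \forall z \near (x, y), forall i, K z.1 -> `|h i x - h i z.1| < r.
    exact: (cvg_fst nx).
  have ny' : \forall z \near (x, y), forall i, K z.2 -> `|h i y - h i z.2| < r.
    exact: (cvg_snd ny).
  by apply: filterS2 nx' ny' => z zx zy K1 K2 i; split; [apply: zx | apply: zy].
have covd : \forall d \near 0^'+, K `*` K `<=` P d.
  apply: cov => -[x y] [/= Kx Ky].
  have [/forallP lt_e|] := boolP [forall j, `|g j x - g j y| < e].
    have nz : \forall z \near (x, y), forall j, K z.1 -> K z.2 -> `|g j z.1 - g j z.2| < e.
      apply: (@filter_forall _ _ (fun j (z : X * X) =>
        K z.1 -> K z.2 -> `|g j z.1 - g j z.2| < e) (nbhs (x, y)) _) => j.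
      have r0 : 0 < (e - `|g j x - g j y|) / 2 by rewrite divr_gt0 // subr_gt0.
      apply: filterS (near2 _ g x y _ r0 cg Kx Ky) => z zP K1 K2.
      have [z1 z2] := zP K1 K2 j; move: z1 z2; rewrite (distrC (g j x) (g j z.1)).
      have : `|g j z.1 - g j z.2| <= `|g j z.1 - g j x| + `|g j x - g j y| + `|g j y - g j z.2|.
        apply: le_trans (ler_distD (g j y) _ _) _.
        by rewrite lerD2r ler_distD.
      lra.
    exists ([set z | forall j, K z.1 -> K z.2 -> `|g j z.1 - g j z.2| < e], setT) => /=.
      by split=> //; apply: filterT.
    by move=> [z d] [/= zP _] K1 K2 _ j; apply: zP.
  rewrite negb_forall => /existsP[j ge_e].
  have [i fi] : exists i, f i x != f i y.
    apply/existsP; apply: contraNT ge_e => /existsPn eqf.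
    rewrite (fg x y Kx Ky) ?subrr ?normr0 // => i; apply/eqP.
    by rewrite -[_ == _]negbK eqf.
  (* Some [f i] separates the pair: two errors below a quarter of the gap and a distance below half
     of it cannot add up to the gap. *)
  have r0 : 0 < `|f i x - f i y| / 4 by rewrite divr_gt0 // normr_gt0 subr_eq0.
  exists ([set z | K z.1 -> K z.2 ->
      forall i', `|f i' x - f i' z.1| < `|f i x - f i y| / 4 /\
                 `|f i' y - f i' z.2| < `|f i x - f i y| / 4],
     [set d | d < `|f i x - f i y| / 2]) => /=.
    split; first exact: near2.
    by apply: nbhs_right_lt; rewrite divr_gt0 // normr_gt0 subr_eq0.
  move=> [z d] [/= zP dP] K1 K2 /(_ i) fd.
  have [z1 z2] := zP K1 K2 i.
  exfalso; move: z1 z2; have := lt_trans fd dP.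
  have : `|f i x - f i y| <= `|f i x - f i z.1| + `|f i z.1 - f i z.2| + `|f i y - f i z.2|.
    rewrite (distrC (f i y)); apply: le_trans (ler_distD (f i z.2) _ _) _.
    by rewrite lerD2r ler_distD.
  lra.
have [d [d0 Pd]] : exists d : R, 0 < d /\ K `*` K `<=` P d.
  have /filter_ex[d [? ?]] :=
    @filterI _ (0^'+) (at_right_proper_filter (0 : R)) _ _ covd (nbhs_right_gt (0 : R)).
  by exists d.
by exists d => // x y Kx Ky; apply: (Pd (x, y)).
Qed.

End Uniform.

Section Embedding.
Variables (R : realType) (n : nat).
Implicit Types (x y : 'rV[R]_n) (vs : seq 'I_n).

Lemma simplex_le1 vs (x : 'rV[R]_n) i : simplex vs x -> x ord0 i <= 1.
Proof. by move=> [x0 <- _]; rewrite (bigD1 i) //= lerDl sumr_ge0. Qed.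

Lemma simplex_compact vs : compact (simplex vs : set 'rV[R]_n).
Proof.
have -> : simplex vs = [set x : 'rV[R]_n | forall i, (`[0, 1]%classic : set R) (x ord0 i)] `&`
    ([set x : 'rV[R]_n | \sum_i x ord0 i = 1] `&`
     \bigcap_(i in [set i | i \notin vs]) ((fun x : 'rV[R]_n => x ord0 i) @^-1` [set 0])).
  apply/seteqP; split => x.
    move=> sx; have [x0 x1 xvs] := sx; split=> // i /=.
    by rewrite in_itv /= x0 (simplex_le1 _ sx).
  move=> [x01 [x1 xvs]]; split=> // i; have := x01 i.
  by rewrite /= in_itv => /andP[].
apply: compact_closedI.
  have c01 (i : 'I_n) : compact (`[0, 1]%classic : set R) by exact: segment_compact.
  exact: (rV_compact c01).
apply: closedI.
  apply: (@preimage_closed _ _ (fun x : 'rV[R]_n => \sum_i x ord0 i) [set 1]).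
    move=> x _; elim: (index_enum _) => [|i s IH].
      rewrite (_ : (fun _ => _) = fun=> 0); last by apply/funext => y; rewrite big_nil.
      exact: cst_continuous.
    rewrite (_ : (fun _ => _) = fun y : 'rV[R]_n => y ord0 i + \sum_(j <- s) y ord0 j).
      by apply: cvgD IH; apply: coord_continuous.
    by apply/funext => y; rewrite big_cons.
  exact: closed_eq.
apply: closed_bigI => i _; apply: preimage_closed; last exact: closed_eq.
by move=> x _; apply: coord_continuous.
Qed.

(** Both uniformity conditions come from [uniform_on_compact], with the coordinates and [h] in
    exchanged roles. *)
Lemma no_embedding m vs (h : 'I_m -> 'rV[R]_n -> R) :
  uniq vs -> size vs = m.+2 ->
  (forall j, cont_on (simplex vs) (h j)) ->
  (forall x y, simplex vs x -> simplex vs y -> (forall j, h j x = h j y) -> x = y) ->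
  False.
Proof.
move=> uvs szvs ch injh.
have cc i : cont_on (simplex vs) (fun x : 'rV[R]_n => x ord0 i).
  move=> x _ e e0; have /cvgrPdist_lt/(_ e e0) := @coord_continuous R 1 n ord0 i x.
  by apply: filterS.
apply: (@no_uniform_embedding R n m vs h uvs szvs).
- move=> e e0.
  have [|d d0 dP] := uniform_on_compact (simplex_compact (vs := vs)) cc ch _ e0.
    by move=> x y _ _ xy j; congr h; apply/rowP => i; apply: xy.
  by exists d.
- move=> e e0.
  have [|d d0 dP] := uniform_on_compact (simplex_compact (vs := vs)) ch cc _ e0.
    by move=> x y sx sy xy j; rewrite (injh x y).
  by exists d.
Qed.

End Embedding.

(** * Dimension of a complex homeomorphic to a sphere *)

Section LinkDimension.
Variables (R : realType) (n : nat) (L : {set {set 'I_n}}).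
Hypothesis L_sub : forall s t : {set 'I_n},
  s \in L -> t != finset.set0 -> t \subset s -> t \in L.

Lemma simplex_realization (s : {set 'I_n}) (x : 'rV[R]_n) :
  s \in L -> simplex (enum s) x -> realization L x.
Proof.
move=> sL [x0 x1 xs]; split=> //; split=> //; apply: L_sub sL _ _.
  apply/eqP => supp0; have : \sum_i x ord0 i = 0.
    apply: big1 => i _; apply/eqP; rewrite -[_ == _]negbK; apply/negP => xi.
    by have := finset.in_set0 i; rewrite -supp0 inE xi.
  by rewrite x1 => /eqP; rewrite oner_eq0.
apply/fintype.subsetP => i; rewrite inE => xi; apply: contraNT xi => si.
by rewrite xs // mem_enum.
Qed.

Lemma simplex_convex vs (x y : 'rV[R]_n) c : 0 <= c <= 1 ->
  simplex vs x -> simplex vs y -> simplex vs (x + c *: (y - x)).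
Proof.
move=> /andP[c0 c1] [x0 x1 xs] [y0 y1 ys]; split=> [i||i vi].
- rewrite !mxE; have := x0 i; have := y0 i; move: (x _ _) (y _ _) => a b b0 a0.
  have -> : a + c * (b - a) = (1 - c) * a + c * b by ring.
  by rewrite addr_ge0 // mulr_ge0 // subr_ge0.
- under eq_bigr => i _ do rewrite !mxE.
  by rewrite big_split /= -mulr_sumr sumrB x1 y1 subrr mulr0 addr0.
- by rewrite !mxE xs // ys // subrr mulr0 addr0.
Qed.

(** A face with [d + 1] vertices would embed into the unit sphere of [R^d]; near a point where
    coordinate [k] is nonzero, dropping that coordinate embeds a simplex into [R^(d - 1)], against
    [no_embedding]. *)
Lemma card_le_sphere_dim d s :
  homeomorphic (@realization R n L) (@sphere R d) -> s \in L -> (#|s| <= d)%N.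
Proof.
move=> L_sphere sL; rewrite leqNgt; apply/negP => /card_geqP[vs [uvs szvs vss]].
case: L_sphere => F [G [FS [_ [GF [_ [cF _]]]]]].
have [i0 i0vs] : exists i0, i0 \in vs.
  by case: vs szvs {uvs vss} => // i ?; exists i; rewrite mem_head.
have tL : [set i in vs] \in L.
  apply: L_sub sL _ _; last by apply/fintype.subsetP => i; rewrite inE => /vss.
  by apply/set0Pn; exists i0; rewrite inE.
have toL (x : 'rV[R]_n) : simplex vs x -> realization L x.
  move=> [x0 x1 xvs]; apply: (simplex_realization tL); split=> // i.
  by rewrite mem_enum inE; apply: xvs.
set p : 'rV[R]_n := delta_mx ord0 i0.
have ps : simplex vs p by apply: simplex_hull; apply: hull_mem; apply: map_f.
have [k Fpk] : exists k, F p ord0 k != 0.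
  apply/existsP; apply: contraT => /existsPn F0.
  have := FS _ (toL _ ps); rewrite /sphere big1 => [/esym/eqP|i _].
    by rewrite oner_eq0.
  by have := F0 i; rewrite negbK => /eqP ->; rewrite expr0n.
have [r r0 rP] : exists2 r : R, 0 < r & forall x : 'rV[R]_n, (forall i, `|p ord0 i - x ord0 i| < r) ->
    realization L x -> `|F p ord0 k - F x ord0 k| < `|F p ord0 k|.
  have Fk0 : 0 < `|F p ord0 k| by rewrite normr_gt0.
  have /nbhs_ballP[r /= r0 rP] := within_cont_on k cF (toL _ ps) Fk0.
  exists r => // x px Lx; apply: rP => //; split=> // i j; rewrite ord1; exact: px.
(* Shrinking the simplex towards the vertex [p] keeps coordinate [k] of [F] away
   from zero, where the other coordinates determine a point of the sphere. *)
pose c := Num.min 1 (r / 2).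
have c0 : 0 < c by rewrite lt_min ltr01 divr_gt0.
have c1 : c <= 1 by rewrite ge_min lexx.
have cr : c < r.
  by rewrite (@le_lt_trans _ _ (r / 2)) // ?ge_min ?lexx ?orbT //; lra.
pose A (x : 'rV[R]_n) := p + c *: (x - p).
have As x : simplex vs x -> simplex vs (A x).
  by apply: simplex_convex => //; rewrite ltW.
have Ak x : simplex vs x -> `|F p ord0 k - F (A x) ord0 k| < `|F p ord0 k|.
  move=> sx; apply: rP; last by apply: toL; apply: As.
  move=> i; rewrite !mxE opprD addNKr normrN normrM (gtr0_norm c0).
  apply: le_lt_trans cr; rewrite -[leRHS]mulr1 ler_pM2l //.
  have [[x0 _ _] [p0 _ _]] := (sx, ps).
  have := x0 i; have := simplex_le1 i sx; have := p0 i; have := simplex_le1 i ps.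
  by rewrite /p mxE ler_norml; lra.
have Ainj x y : A x = A y -> x = y.
  by move=> /addrI /(scalerI (lt0r_neq0 c0)) /addIr.
have cA x (Q : set 'rV[R]_n) : nbhs (A x) Q -> \forall y \near x, Q (A y).
  move=> /nbhs_ballP[e /= e0 eQ]; apply/nbhs_ballP; exists e => //= y [_ xy].
  apply: eQ; split=> // i j; have := xy i j; rewrite /ball /= !mxE.
  rewrite opprD addrACA subrr add0r -mulrBr opprB addrA subrK.
  rewrite normrM (gtr0_norm c0); apply: le_lt_trans.
  by rewrite ler_piMl // normr_ge0.
have sphere_inj (x y : 'rV[R]_d) : sphere x -> sphere y -> (forall j, j != k -> x ord0 j = y ord0 j) ->
    `|F p ord0 k - x ord0 k| < `|F p ord0 k| ->
    `|F p ord0 k - y ord0 k| < `|F p ord0 k| -> x = y.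
  rewrite /sphere => Sx Sy exy xk yk; apply/rowP => j.
  have [->{j}|/exy //] := eqVneq j k.
  have : x ord0 k ^+ 2 = y ord0 k ^+ 2.
    move: Sx; rewrite -Sy (bigD1 k) //= [RHS](bigD1 k) //=.
    under eq_bigr => j jk do rewrite exy //.
    exact: addIr.
  (* Both values have the sign of [F p ord0 k], which excludes opposite ones. *)
  move/eqP; rewrite eqf_sqr => /orP[/eqP //|/eqP xy].
  move: xk yk; rewrite xy; move: (F p ord0 k) Fpk (y ord0 k) => a a0 b.
  by case: (ltrgt0P a) a0 => // a0 _; rewrite !ltr_norml; lra.
have cF' j : cont_on (simplex vs) (fun x => F (A x) ord0 j).
  move=> x sx e e0.
  have := within_cont_on j cF (toL _ (As _ sx)) e0.
  move/cA; apply: filterS => y yP sy.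
  by apply: yP; apply: toL; apply: As.
have [q dE] : exists q, d = q.+1.
  by exists d.-1; rewrite prednK // (leq_ltn_trans _ (ltn_ord k)).
subst d; apply: (@no_embedding R n q vs (fun j x => F (A x) ord0 (lift k j))) => //.
move=> x y sx sy hxy; apply: Ainj; rewrite -(GF _ (toL _ (As _ sx))).
rewrite -(GF _ (toL _ (As _ sy))); congr G.
apply: sphere_inj; try exact: Ak; try by apply: FS; apply: toL; apply: As.
by move=> j; rewrite eq_sym => /unlift_some[j' -> _]; apply: hxy.
Qed.

End LinkDimension.

(** * Lower links of [u] and [v] before and after the crossing *)

Theorem theorem1 (R : realType) (d n : nat) (K : {set {set 'I_n}})
  (f : R -> 'I_n -> R) (u v : 'I_n) (t1 t2 : R) :
  combinatorial_manifold R d K ->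
  generic_family f ->
  u != v ->
  0 <= t1 -> t1 < t2 -> t2 <= 1 ->
  f t1 u < f t1 v ->
  f t2 v < f t2 u ->
  (exists t, [/\ t1 < t, t < t2 & f t u = f t v] /\
     forall t', t1 < t' -> t' < t2 -> f t' u = f t' v -> t' = t) ->
  (forall (t : R) (x y : 'I_n), t1 <= t -> t <= t2 -> x != y -> f t x = f t y ->
     [set x; y] = [set u; v]) ->
  \sum_(i < d.+1) (-1) ^+ i * ((beta K f t2 v i)%:Z - (beta K f t1 v i)%:Z)
  = - \sum_(i < d.+1) (-1) ^+ i * ((beta K f t2 u i)%:Z - (beta K f t1 u i)%:Z) :> int.
Proof.
move=> [cK Ksphere] [cf _] uv t1ge0 t12 t2le1 uv1 vu2 [t0 [[t10 t02 uv0] _]] cross.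
have t1le := ltW t12.
have le_const x w : x != u -> x != v -> (w == u) || (w == v) ->
    forall t t', t1 <= t <= t2 -> t1 <= t' <= t2 -> (f t x <= f t w) = (f t' x <= f t' w).
  move=> xu xv wuv; apply: (noncrossing_le cf t1ge0 t2le1) => t /andP[ht1 ht2].
  have xw : x != w by case/orP: wuv => /eqP ->.
  apply/eqP => /(cross t x w ht1 ht2 xw) E.
  have : [set u; v] x by rewrite -E; left.
  by case=> [xu'|xv']; [rewrite xu' eqxx in xu | rewrite xv' eqxx in xv].
have h1 : t1 <= t1 <= t2 by rewrite lexx.
have h2 : t1 <= t2 <= t2 by rewrite lexx andbT.
have h0 : t1 <= t0 <= t2 by rewrite !ltW.
pose P : pred 'I_n := fun x => [&& x != u, x != v & f t1 x <= f t1 v].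
have Pv t x : t1 <= t <= t2 -> x != u -> x != v -> (f t x <= f t v) = P x.
  by move=> ht xu xv; rewrite /P xu xv (le_const x v xu xv _ t t1) ?eqxx ?orbT.
(* The same [P] serves [u] and [v], because their values agree at the crossing time [t0]. *)
have Pu t x : t1 <= t <= t2 -> x != u -> x != v -> (f t x <= f t u) = P x.
  move=> ht xu xv; rewrite (le_const x u xu xv _ t t0) ?eqxx // uv0.
  exact: Pv.
have Lv1 : lower_link K f t1 v = link_above K P v u.
  apply: lower_linkE => // x xv; have [->|xu] /= := eqVneq x u; first by rewrite ltW.
  exact: Pv.
have Lv2 : lower_link K f t2 v = link_below K P v u.
  apply: lower_linkE => // x xv; have [->|xu] /= := eqVneq x u; last exact: Pv.
  by rewrite leNgt vu2.
have Lu2 : lower_link K f t2 u = link_above K P u v.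
  apply: lower_linkE => // x xu; have [->|xv] /= := eqVneq x v; first by rewrite ltW.
  exact: Pu.
have Lu1 : lower_link K f t1 u = link_below K P u v.
  apply: lower_linkE => // x xu; have [->|xv] /= := eqVneq x v; last exact: Pu.
  by rewrite leNgt uv1.
have euler t w : \sum_(i < d.+1) (-1) ^+ i * (beta K f t w i)%:Z =
    \sum_(i < d.+1) (-1) ^+ i * #|faces (lower_link K f t w) i|%:Z.
  apply: euler_poincare => s; first exact: lower_link_sub.
  rewrite mem_lower_link => /andP[sLk _].
  by apply: card_le_sphere_dim sLk; [exact: Lk_sub | exact: Ksphere].
under eq_bigr => i _ do rewrite mulrBr.
under [in RHS]eq_bigr => i _ do rewrite mulrBr.
rewrite !sumrB !euler -!sumrB -sumrN.
apply: eq_bigr => i _; rewrite Lv1 Lv2 Lu1 Lu2.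
have [Pu0 Pv0] : P u = false /\ P v = false by rewrite /P !eqxx andbF.
(* In each size [i], [v] loses the faces through [u] and [u] gains as many faces through [v]. *)
rewrite (card_link_above K v i Pu0) (card_link_above K u i Pv0).
rewrite (card_link_through P cK i uv) !PoszD.
by move: ((-1) ^+ i) (Posz _) (Posz _) (Posz _) => e x y z; ring.
Qed.
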